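(* The set $\mathcal M$ of even Laurent monomials, equipped with the maps $\mathrm{wt}$, $\varepsilon_x$, $\varphi_x$, $\tilde e_x$, $\tilde f_x$ ($x\in\underline I$) defined in the context, is a crystal of type $\underline C$ (in the sense of Kashiwara).
   Context: **Cartan data.** $(c_{ij})_{i,j\in I}$ is an indecomposable Cartan matrix of finite type, $d_i$ positive integers with gcd $1$ and $b_{ij}:=d_ic_{ij}=d_jc_{ji}$. $Q=(I,E)$ has exactly one arrow between $i\neq j$ whenever $c_{ij}<0$, oriented from $p=0$ to $p=1$ for a bipartition $p$ of $I$; in non simply laced types $p$ is chosen so that the arrow between adjacent vertices with $d_i\neq d_j$ goes from the smaller to the larger $d$. The equivalence relation on $I\times\mathbb Z$ generated by $(i,r)\sim(j,s)$ if $b_{ij}\neq0$ and $s=r+b_{ij}$ has two classes; ${}^0I$ is the class containing the $(i,p(i))$ in simply laced types, and the class containing $(i,0)$ for $d_i>1$ otherwise. $\underline I=\{(i,r)\in{}^0I:1\le r\le 2d_i\}$; $\underline Q$ is the quiver on $\underline I$ with one arrow $(i,r)\to(j,s)$ whenever $i\to j\in E$ and $s-r+b_{ij}\in2\gcd(d_i,d_j)\mathbb Z$; $\underline C$ is its (symmetric, finite type) Cartan matrix. **Monomials.** For a finitely supported family of integers $u=(u_{i,k})_{(i,k)\in I\times\mathbb Z}$ put $\mathbf z^u=\prod\mathbf z_{i,k}^{u_{i,k}}$ (Laurent monomial in independent variables). It is even if $u_{i,k}=0$ for $(i,k)\notin{}^0I$; $\mathcal M$ is the set of even monomials. Put $$\mathbf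 a_{i,k}=\mathbf z_{i,k}\,\mathbf z_{i,k+2d_i}\prod_{c_{ij}<0}\prod_{n=1}^{-c_{ij}}\mathbf z_{j,k+b_{ij}+2d_in}^{-1}.$$ For $x=(i,r)\in\underline I$ and $k\in\mathbb Z$, the pair $(x,k)$ is even if $k\equiv r\bmod 2d_i$; in that case $u_{x,k}:=u_{i,k}$ and $\mathbf a_{x,k}:=\mathbf a_{i,k}$. **Structure maps.** All integers $k,l$ below are such that $(x,k)$, $(x,l)$ are even. $\mathrm{wt}(\mathbf z^u)=\sum_{x,k}u_{x,k}\,\delta_x$, where $\delta_x$ is identified with the fundamental weight of $\underline C$ at $x$ (so the simple root at $x$ is $\underline C\delta_x$); $\varepsilon_{x,l}(\mathbf z^u)=-\sum_{k\le l}u_{x,k}$, $\varphi_{x,l}(\mathbf z^u)=\sum_{k>l}u_{x,k}$; $\varepsilon_x(\mathbf z^u)=\max_l\varepsilon_{x,l}(\mathbf z^u)$, $\varphi_x(\mathbf z^u)=\max_l\varphi_{x,l}(\mathbf z^u)$; $m_x=\min\{l:\varepsilon_{x,l}(\mathbf z^u)=\varepsilon_x(\mathbf z^u)\}$ (exists if $\varepsilon_x>0$), $n_x=\max\{l:\varphi_{x,l}(\mathbf z^u)=\varphi_x(\mathbf z^u)\}$ (exists if $\varphi_x>0$); $\tilde e_x(\mathbf z^u)=0$ if $\varepsilon_x(\mathbf z^u)=0$ and $\mathbf z^u\mathbf a_{x,m_x}$ otherwise; $\tilde f_x(\mathbf z^u)=0$ if $\varphi_x(\mathbf z^u)=0$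 and $\mathbf z^u\mathbf a_{x,n_x}^{-1}$ otherwise. **Crystal.** A set $B$ with maps $\mathrm{wt}$ to the weight lattice, $\varepsilon_x,\varphi_x:B\to\mathbb Z$ and $\tilde e_x,\tilde f_x:B\to B\sqcup\{0\}$ is a crystal if for all $x$ and $b,b'\in B$: $\varphi_x(b)-\varepsilon_x(b)$ is the coefficient of the $x$-th fundamental weight in $\mathrm{wt}(b)$; if $\tilde e_xb\in B$ then $\mathrm{wt}(\tilde e_xb)=\mathrm{wt}(b)+\alpha_x$, $\varepsilon_x(\tilde e_xb)=\varepsilon_x(b)-1$, $\varphi_x(\tilde e_xb)=\varphi_x(b)+1$; if $\tilde f_xb\in B$ then $\mathrm{wt}(\tilde f_xb)=\mathrm{wt}(b)-\alpha_x$, $\varepsilon_x(\tilde f_xb)=\varepsilon_x(b)+1$, $\varphi_x(\tilde f_xb)=\varphi_x(b)-1$; and $b'=\tilde f_xb$ iff $b=\tilde e_xb'$ ($\alpha_x$ = simple root). *)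

(* Defs.v *)
From HB Require Import structures.
From Stdlib Require Import Relation_Operators.
From mathcomp Require Import all_boot all_order all_algebra finmap.
From mathcomp Require Import all_classical.
From mathcomp Require Import monalg.

Set Implicit Arguments.
Unset Strict Implicit.
Unset Printing Implicit Defensive.

Import Order.TTheory GRing.Theory Num.Theory.
Local Open Scope classical_set_scope.
Local Open Scope ring_scope.

(* The default [z0] is returned only when there is no maximum (minimum). *)
Definition maxZ (z0 : int) (A : set int) : int := xget z0 (A `&` ubound A).
Definition minZ (z0 : int) (A : set int) : int := xget z0 (A `&` lbound A).

Definition is_gcm (I : finType) (c : I -> I -> int) : Prop :=
  [/\ forall i, c i i = 2,
      forall i j, i != j -> c i j <= 0
    & forall i j, c i j = 0 -> c j i = 0].

Definition indecomposable (I : finType) (c : I -> I -> int) : Prop :=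
  (0 < #|I|)%N /\
  forall J : {set I}, J != finset.set0 -> J != [set: I]%SET ->
    exists i j, [/\ i \in J, j \notin J & c i j != 0].

Definition finite_type (I : finType) (c : I -> I -> int) : Prop :=
  exists d : I -> nat,
    [/\ forall i, (0 < d i)%N,
        forall i j, (d i)%:Z * c i j = (d j)%:Z * c j i
      & forall v : I -> rat, (exists i, v i != 0) ->
          0 < \sum_i \sum_j v i * ((d i)%:Z * c i j)%:~R * v j].

Record cartan_datum (I : finType) := CartanDatum {
  cij : I -> I -> int;
  dsym : I -> nat;
  (* the bipartition, [false] being 0 and [true] being 1 *)
  parity : I -> bool;
  cij_gcm : is_gcm cij;
  cij_indec : indecomposable cij;
  cij_fin : finite_type cij;
  dsym_gt0 : forall i, (0 < dsym i)%N;
  dsym_gcd : \big[gcdn/0%N]_(i : I) dsym i = 1%N;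
  dsymP : forall i j, (dsym i)%:Z * cij i j = (dsym j)%:Z * cij j i;
  parityP : forall i j, cij i j < 0 -> parity i != parity j;
  (* vacuous in simply laced types, where all [dsym i] are 1 *)
  parity_dsym : forall i j, cij i j < 0 -> (dsym i < dsym j)%N ->
    parity i = false /\ parity j = true }.

Section Data.
Context (I : finType) (D : cartan_datum I).
Local Notation c := (cij D).
Local Notation d := (dsym D).
Local Notation p := (parity D).

Definition bmat (i j : I) : int := (d i)%:Z * c i j.

Definition Qarrow (i j : I) : bool := [&& c i j < 0, ~~ p i & p j].

Definition simply_laced : bool :=
  [forall i, forall j, (i != j) ==> ((c i j == 0) || (c i j == -1))].

Local Notation vertex := (I * int)%type.

Definition gen_step (q q' : vertex) : Prop :=
  bmat q.1 q'.1 != 0 /\ q'.2 = q.2 + bmat q.1 q'.1.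

Definition equivIZ : vertex -> vertex -> Prop :=
  clos_refl_sym_trans vertex gen_step.

(* The distinguished class 0I: the base points below are all equivalent, so
   that belonging to their class is being equivalent to one of them. *)
Definition evenI (q : vertex) : Prop :=
  if simply_laced then exists i, equivIZ (i, (p i)%:Z) q
  else exists i, (1 < d i)%N /\ equivIZ (i, 0) q.

(* [(i, r)] with [r] in [0, 2 d_i], subject to [1 <= r] and [evenI (i, r)] *)
Definition uI_pred (x : {i : I & 'I_(2 * d i).+1}) : bool :=
  (0 < tagged x)%N && `[< evenI (tag x, (tagged x : nat)%:Z) >].

Definition uI : Type := {x : {i : I & 'I_(2 * d i).+1} | uI_pred x}.
HB.instance Definition _ := Finite.on uI.

Definition ui (x : uI) : I := tag (sval x).
Definition ur (x : uI) : int := (tagged (sval x) : nat)%:Z.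

Definition uQarrow (x y : uI) : bool :=
  Qarrow (ui x) (ui y) &&
  ((2 * gcdn (d (ui x)) (d (ui y)))%N%:Z
     %| ur y - ur x + bmat (ui x) (ui y))%Z.

Definition uC (x y : uI) : int :=
  2 * (x == y)%:Z - (uQarrow x y)%:Z - (uQarrow y x)%:Z.

(* The Laurent monomial z^u is represented by its exponent family u, so that
   the product of monomials is written additively. *)
Local Notation mono := {malg int[vertex]}.

Definition zvar (i : I) (k : int) : mono := << (i, k) >>.

Definition expo (u : mono) (i : I) (k : int) : int := u@_(i, k).

Definition even_mono (u : mono) : Prop :=
  forall q : vertex, ~ evenI q -> u@_q = 0.

Definition evenM : Type := {u : mono | `[< even_mono u >]}.
Coercion mono_of_even (u : evenM) : mono := sval u.

Definition amono (i : I) (k : int) : mono :=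
  zvar i k + zvar i (k + 2 * (d i)%:Z)
  - \sum_(j | c i j < 0) \sum_(1 <= n < (absz (c i j)).+1)
      zvar j (k + bmat i j + 2 * (d i)%:Z * n%:Z).

Definition even_pair (x : uI) (k : int) : bool :=
  (k == ur x %[mod (2 * d (ui x))%N%:Z])%Z.

(* A weight is given by its coordinates on the fundamental weights. *)
Definition fundw (x : uI) : {ffun uI -> int} := [ffun y => (x == y)%:Z].

Definition wt (u : mono) : {ffun uI -> int} :=
  \sum_(x : uI) \sum_(k \in [set k | even_pair x k]) fundw x *~ expo u (ui x) k.

Definition epsl (x : uI) (l : int) (u : mono) : int :=
  - \sum_(k \in [set k | even_pair x k /\ k <= l]) expo u (ui x) k.

Definition phil (x : uI) (l : int) (u : mono) : int :=
  \sum_(k \in [set k | even_pair x k /\ l < k]) expo u (ui x) k.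

Definition eps (x : uI) (u : mono) : int :=
  maxZ 0 [set epsl x l u | l in [set l | even_pair x l]].

Definition phi (x : uI) (u : mono) : int :=
  maxZ 0 [set phil x l u | l in [set l | even_pair x l]].

(* The default value [ur x] is only there to make [even_pair x (mx x u)] and
   [even_pair x (nx x u)] hold for all [u]. *)
Definition mx (x : uI) (u : mono) : int :=
  minZ (ur x) [set l | even_pair x l /\ epsl x l u = eps x u].

Definition nx (x : uI) (u : mono) : int :=
  maxZ (ur x) [set l | even_pair x l /\ phil x l u = phi x u].

Lemma even_pair_mx x u : even_pair x (mx x u).
Proof.
by rewrite /mx /minZ; case: xgetP => [l -> [[]] //|_]; rewrite /even_pair.
Qed.

Lemma even_pair_nx x u : even_pair x (nx x u).
Proof.
by rewrite /nx /maxZ; case: xgetP => [l -> [[]] //|_]; rewrite /even_pair.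
Qed.

Lemma evenI_equiv q q' : equivIZ q q' -> evenI q -> evenI q'.
Proof.
move=> qq'; rewrite /evenI; case: ifP => _ [i].
  by move=> iq; exists i; apply: rst_trans iq qq'.
by move=> [di iq]; exists i; split => //; apply: rst_trans iq qq'.
Qed.

Lemma equivIZ_period i (k m : int) :
  equivIZ (i, k) (i, k + 2 * (d i)%:Z * m).
Proof.
have bii : bmat i i = 2 * (d i)%:Z.
  by rewrite /bmat; case: (cij_gcm D) => -> _ _; rewrite mulrC.
have step k' : equivIZ (i, k') (i, k' + 2 * (d i)%:Z).
  apply: rst_step; split => /=; rewrite bii //.
  by rewrite mulf_neq0 // eqz_nat -lt0n dsym_gt0.
have stepn (n : nat) k' : equivIZ (i, k') (i, k' + 2 * (d i)%:Z * n%:Z).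
  elim: n k' => [|n IHn] k'; first by rewrite mulr0 addr0; apply: rst_refl.
  rewrite intS mulrDr mulr1 addrA; apply: rst_trans (step k') _.
  exact: IHn.
case: m => n; first exact: stepn.
rewrite NegzE mulrN; apply: rst_sym.
by have := stepn n.+1 (k - 2 * (d i)%:Z * n.+1%:Z); rewrite subrK.
Qed.

Lemma evenI_pair x k : even_pair x k -> evenI (ui x, k).
Proof.
rewrite /even_pair eqz_mod_dvd => /dvdzP[m km].
have evx : evenI (ui x, ur x) by have /andP[_ /asboolP] := svalP x.
apply: evenI_equiv evx.
have -> : k = ur x + 2 * (d (ui x))%:Z * m.
  by rewrite -PoszM [_ * m]mulrC -km addrC subrK.
exact: equivIZ_period.
Qed.

Lemma even_mono_zvar i k : evenI (i, k) -> even_mono (zvar i k).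
Proof.
move=> ev q nev; rewrite /zvar mcoeffU.
by case: eqP => // qE; case: nev; rewrite -qE.
Qed.

Lemma even_monoD u v : even_mono u -> even_mono v -> even_mono (u + v).
Proof. by move=> ue ve q nq; rewrite mcoeffD ue // ve // addr0. Qed.

Lemma even_monoN u : even_mono u -> even_mono (- u).
Proof. by move=> ue q nq; rewrite mcoeffN ue // oppr0. Qed.

Lemma even_mono0 : even_mono 0.
Proof. by move=> q nq; rewrite mcoeff0. Qed.

Lemma even_mono_a i k : evenI (i, k) -> even_mono (amono i k).
Proof.
move=> ev; apply: even_monoD; last apply: even_monoN.
  apply: even_monoD; apply: even_mono_zvar => //.
  by apply: evenI_equiv ev; rewrite -[2 * _]mulr1; apply: equivIZ_period.
apply: (big_ind even_mono); [exact: even_mono0 | exact: even_monoD | move=> j cj].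
apply: (big_ind even_mono); [exact: even_mono0 | exact: even_monoD | move=> n _].
apply: even_mono_zvar; apply: evenI_equiv ev.
apply: (@rst_trans _ _ _ (i, k + 2 * (d i)%:Z * n%:Z)).
  exact: equivIZ_period.
apply: rst_step; split => /=; last by rewrite addrAC.
by apply: mulf_neq0; [rewrite eqz_nat -lt0n dsym_gt0 | exact: ltr0_neq0].
Qed.

Definition ax (x : uI) (k : int) : mono := amono (ui x) k.

Lemma e_even (x : uI) (u : evenM) :
  `[< even_mono ((u : mono) + ax x (mx x u)) >].
Proof.
apply/asboolP; apply: even_monoD; first exact/asboolP/(svalP u).
exact/even_mono_a/evenI_pair/even_pair_mx.
Qed.

Lemma f_even (x : uI) (u : evenM) :
  `[< even_mono ((u : mono) - ax x (nx x u)) >].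
Proof.
apply/asboolP; apply: even_monoD; first exact/asboolP/(svalP u).
exact/even_monoN/even_mono_a/evenI_pair/even_pair_nx.
Qed.

(* [None] is the extra element 0 of the codomain. *)
Definition etilde (x : uI) (u : evenM) : option evenM :=
  if eps x u == 0 then None
  else Some (exist _ ((u : mono) + ax x (mx x u)) (e_even x u)).

Definition ftilde (x : uI) (u : evenM) : option evenM :=
  if phi x u == 0 then None
  else Some (exist _ ((u : mono) - ax x (nx x u)) (f_even x u)).

End Data.

(* The simple root at [x] is the column [C delta_x]. *)
Definition simple_root (J : finType) (C : J -> J -> int) (x : J) :
  {ffun J -> int} := [ffun y => C y x].

Record is_crystal (J : finType) (C : J -> J -> int) (B : Type)
    (wtB : B -> {ffun J -> int}) (epsB phiB : J -> B -> int)
    (e f : J -> B -> option B) : Prop := IsCrystal {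
  crystal_wt : forall x b, phiB x b - epsB x b = wtB b x;
  crystal_e : forall x b b', e x b = Some b' ->
    [/\ wtB b' = wtB b + simple_root C x,
        epsB x b' = epsB x b - 1 & phiB x b' = phiB x b + 1];
  crystal_f : forall x b b', f x b = Some b' ->
    [/\ wtB b' = wtB b - simple_root C x,
        epsB x b' = epsB x b + 1 & phiB x b' = phiB x b - 1];
  crystal_ef : forall x b b', f x b = Some b' <-> e x b' = Some b }.

(* Main.v *)
(* Write E(l) = epsilon_{x,l}(z^u); then phi_{x,l} = wt_x + E(l), so phi_x and
   eps_x differ by wt_x, and m_x, n_x are the first and last points where E is
   maximal.  Multiplying by a_{x,m} only changes E by -1 on [m, m + 2d[ and by
   -2 on [m + 2d, +oo[ (the admissible l being 2d apart): at the first maximum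
   this lowers the maximum by exactly 1 and makes m the last maximum of the new
   function, whence the axioms for e and f e = id; f is treated symmetrically.
   That a_{x,k} has weight the simple root at x is a count: as c_ij = -1 or
   c_ji = -1 in finite type, exactly one of the factors z_{j,k+b_ij+2d_i n} lies
   on the string of a given y above j if the congruence modulo 2 gcd(d_i, d_j)
   defining the arrows between x and y holds, and none otherwise. *)

From HB Require Import structures.
Require Import Defs.
From mathcomp Require Import all_boot all_order all_algebra finmap.
From mathcomp Require Import all_classical.
From mathcomp Require Import monalg zify ring.

Set Implicit Arguments.
Unset Strict Implicit.
Unset Printing Implicit Defensive.

Import Order.TTheory GRing.Theory Num.Theory.
Local Open Scope classical_set_scope.
Local Open Scope ring_scope.

(** * Extrema of bounded sets of integers *)

Lemma maxZ_eq z0 (A : set int) m : A m -> ubound A m -> maxZ z0 A = m.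
Proof.
move=> Am ubm; apply: xget_unique => [//|y [Ay uby]].
by apply/eqP; rewrite eq_le ubm //= uby.
Qed.

Lemma minZ_eq z0 (A : set int) m : A m -> lbound A m -> minZ z0 A = m.
Proof.
move=> Am lbm; apply: xget_unique => [//|y [Ay lby]].
by apply/eqP; rewrite eq_le lbm //= lby.
Qed.

Lemma maxZP z0 (A : set int) : A !=set0 -> has_ubound A ->
  A (maxZ z0 A) /\ ubound A (maxZ z0 A).
Proof.
move=> [a Aa] [M ubM].
suff [m [Am ubm]] : exists m, A m /\ ubound A m by rewrite (maxZ_eq z0 Am ubm).
(* The gap between [a] and the bound [M] is the induction measure: passing to a larger element of
   [A] shrinks it. *)
have : M <= a + (absz (M - a))%:Z by lia.
move: (absz (M - a)) => n; elim: n a Aa => [|n IHn] a Aa leM.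
  by exists a; split => // b /ubM bM; lia.
have [[b [Ab ab]]|noab] := pselect (exists b, A b /\ a < b).
  by apply: IHn Ab _; lia.
exists a; split => // b Ab; rewrite leNgt; apply/negP => ab.
by apply: noab; exists b.
Qed.

Lemma minZP z0 (A : set int) : A !=set0 -> has_lbound A ->
  A (minZ z0 A) /\ lbound A (minZ z0 A).
Proof.
move=> [a Aa] [M lbM].
have [||[m Am mE] ubm] := @maxZP 0 [set - b | b in A].
- by exists (- a), a.
- by exists (- M) => _ [b /lbM Mb <-]; rewrite lerN2.
suff lbm : lbound A m by rewrite (minZ_eq z0 Am lbm).
move=> b Ab; rewrite -lerN2 mE; apply: ubm; by exists b.
Qed.

(** * Sums of exponents over sets of positions at a fixed vertex *)

Lemma fsumEr (V : zmodType) (T : choiceType) (A : set T) (f : T -> V)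
    (r : {fset T}) : (forall k, k \notin r -> f k = 0) ->
  \sum_(k \in A) f k = \sum_(k <- r | k \in A) f k.
Proof.
move=> f0; rewrite fsbig_mkcond (@fsbigTE _ _ _ _ r) ?[RHS]big_mkcond //.
by move=> k /f0 fk; rewrite /patch fk; case: ifP.
Qed.

Section CoordinateSums.
Context (I : choiceType).
Implicit Types (u v : {malg int[(I * int)%type]}) (A : set int) (i j : I).

(** Common form of [wt], [epsl] and [phil], up to sign: [A] is a residue class, possibly cut by a
    half-line. *)
Definition coordsum A i u : int := \sum_(k \in A) u@_(i, k).

Definition coords u : {fset int} := [fset q.2 | q in msupp u]%fset.

Lemma coords_out u i k : k \notin coords u -> u@_(i, k) = 0.
Proof.
move=> ku; apply: mcoeff_outdom; apply: contra ku => iku.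
by apply/imfsetP; exists (i, k).
Qed.

Lemma coordsumE (r : {fset int}) A i u : (coords u `<=` r)%fset ->
  coordsum A i u = \sum_(k <- r | k \in A) u@_(i, k).
Proof.
move=> /fsubsetP ur; apply: fsumEr => k kr; apply: coords_out.
by apply: contra kr; apply: ur.
Qed.

Lemma coordsum_is_zmod_morphism A i : zmod_morphism (coordsum A i).
Proof.
(* A single finite range containing the positions of all three families, so that the sums can be
   subtracted term by term. *)
move=> u v; pose r := (coords (u - v) `|` coords u `|` coords v)%fset.
rewrite !(@coordsumE r) ?/r; last 3 first.
- by rewrite fsubsetUr.
- by rewrite -fsetUA fsetUC -fsetUA fsubsetUl.
- by rewrite -fsetUA fsubsetUl.
by rewrite -sumrB; apply: eq_bigr => k _; rewrite mcoeffB.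
Qed.

HB.instance Definition _ A i := GRing.isZmodMorphism.Build _ _
  (coordsum A i) (coordsum_is_zmod_morphism A i).

Lemma coordsumU A i j k :
  coordsum A i << (j, k) >> = ((j == i) && (k \in A))%:Z.
Proof.
rewrite /coordsum (@fsumEr _ _ _ _ [fset k]%fset); last first.
  by move=> l; rewrite inE mcoeffU xpair_eqE [k == l]eq_sym => /negPf->; rewrite andbF.
rewrite big_mkcond big_seq_fset1 mcoeffU xpair_eqE eqxx andbT andbC.
by case: (k \in A); case: (j == i).
Qed.

Lemma coordsumID A B i u :
  coordsum A i u = coordsum (A `&` B) i u + coordsum (A `&` ~` B) i u.
Proof.
rewrite !(@coordsumE (coords u)) // (bigID (mem B)) /=; congr (_ + _).
  by apply: eq_bigl => k; rewrite in_setI.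
by apply: eq_bigl => k; rewrite in_setI in_setC.
Qed.

Lemma coordsum0 A i u : (forall k, A k -> u@_(i, k) = 0) -> coordsum A i u = 0.
Proof. by move=> u0; apply: fsbig1. Qed.

(** Uniformity in [A] is the point: it bounds [epsl x l u] for all [l] at once. *)
Lemma coordsum_bounded i u : exists M, forall A, `|coordsum A i u| <= M.
Proof.
exists (\sum_(k <- coords u) `|u@_(i, k)|) => A.
rewrite (@coordsumE (coords u)) //.
apply: le_trans (ler_norm_sum _ _ _) _.
by rewrite big_mkcond; apply: ler_sum => k _; case: ifP.
Qed.

Lemma coords_bounded u : exists N : nat, forall i k,
  (N < `|k|)%N -> u@_(i, k) = 0.
Proof.
exists (\max_(k <- coords u) `|k|%N) => i k; rewrite ltnNge => Nk.
by apply: coords_out; apply: contra Nk => ku; apply: leq_bigmax_seq.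
Qed.

End CoordinateSums.

(** * Arithmetic of the Cartan datum and the weight of [ax] *)

(* When [b = 1], the [n] in [1, a] run over all residues modulo [a = dj / di]. *)
Lemma gcd_dvd_count (di dj a b : nat) (t : int) :
    (0 < di)%N -> (0 < dj)%N -> (di * a = dj * b)%N -> a = 1%N \/ b = 1%N ->
  \sum_(1 <= n < a.+1) ((2 * dj)%N%:Z %| t + 2 * di%:Z * n%:Z)%Z%:Z
    = ((2 * gcdn di dj)%N%:Z %| t)%Z%:Z.
Proof.
move=> di0 dj0 dab [a1|b1].
  (* Here [di = dj * b], so the shift [2 * di] is a multiple of [2 * dj]. *)
  rewrite a1 muln1 in dab *; rewrite big_nat1 dab gcdnC gcdnMr mulr1.
  congr (nat_of_bool _)%:Z; apply: rpredDr.
  by apply/dvdzP; exists b%:Z; lia.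
rewrite b1 muln1 in dab; rewrite -dab gcdnMr.
have a0 : (0 < a)%N by lia.
have [/dvdzP[q tE]|ndv] := boolP ((2 * di)%N%:Z %| t)%Z; last first.
  apply: big1 => n _; case: (boolP (_ %| _)%Z) => // /dvdzP[q qE].
  case/negP: ndv; apply/dvdzP; exists (q * a%:Z - n%:Z).
  by apply: (addIr (2 * di%:Z * n%:Z)); rewrite qE !PoszM; ring.
have dvE n : ((2 * (di * a))%N%:Z %| t + 2 * di%:Z * n%:Z)%Z
           = (a%:Z %| q + n%:Z)%Z.
  rewrite (_ : t + _ = (2 * di)%N%:Z * (q + n%:Z)); last first.
    by rewrite tE !PoszM; ring.
  by rewrite mulnA (PoszM (2 * di)); apply: dvdz_mul2l; lia.
under eq_bigr do rewrite dvE.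
have qa := divz_eq q a%:Z.
have ra : 0 <= (q %% a%:Z)%Z by apply: modz_ge0; lia.
have rb : (q %% a%:Z)%Z < a%:Z by apply: ltz_pmod; lia.
set r := (q %% a%:Z)%Z in qa ra rb.
(* The only solution of [a %| q + n] in the range: as [0 <= r < a], the number [a - r] lies between
   1 and [a]. *)
have n0P : `|a%:Z - r|%N \in index_iota 1 a.+1 by rewrite mem_index_iota; lia.
rewrite (bigD1_seq _ n0P) ?iota_uniq //= big1_seq => [|n].
  rewrite addr0 (_ : (_ %| _)%Z) //; apply/dvdzP; exists ((q %/ a%:Z)%Z + 1).
  rewrite [in LHS]qa; lia.
rewrite mem_index_iota => /and3P[nn0 n1 na].
case: (boolP (_ %| _)%Z) => // /dvdzP[s sE]; case/negP: nn0; apply/eqP.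
(* The multiple [r + n] of [a] lies strictly between 0 and [2 * a], hence equals [a]. *)
have e : (s - (q %/ a%:Z)%Z) * a%:Z = r + n%:Z by rewrite mulrBl -sE {1}qa; ring.
have : s - (q %/ a%:Z)%Z = 1 by nia.
by move=> e1; rewrite e1 in e; lia.
Qed.

Section Crystal.
Context (I : finType) (D : cartan_datum I).
Local Notation c := (cij D).
Local Notation d := (dsym D).
Local Notation mono := {malg int[(I * int)%type]}.
Implicit Types (x y : uI D) (u : mono) (k l m : int).

Lemma cij_eqN1 i j : c i j < 0 -> c i j = -1 \/ c j i = -1.
Proof.
move=> cij0; have [c2 cN cz] := cij_gcm D; have [e [e0 esym epos]] := cij_fin D.
have ij : i != j by apply/eqP => ij; rewrite ij c2 in cij0.
pose v h : rat := (h \in pred2 i j)%:R.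
have sumv (F : I -> rat) : \sum_h v h * F h = F i + F j.
  rewrite (bigD1 i) // (bigD1 j) 1?eq_sym //= big1 => [|h /andP[hi hj]].
    by rewrite /v !inE !eqxx orbT !mul1r addr0.
  by rewrite /v inE /= (negPf hi) (negPf hj) mul0r.
(* If [c i j] and [c j i] were both at most -2, the form would be nonpositive
   at the indicator function of [{i, j}]. *)
have /epos : exists h, v h != 0 by exists i; rewrite /v inE eqxx.
have -> : \sum_h \sum_h' v h * ((e h)%:Z * c h h')%:~R * v h'
    = \sum_h v h * \sum_h' v h' * ((e h)%:Z * c h h')%:~R.
  apply: eq_bigr => h _; rewrite mulr_sumr; apply: eq_bigr => h' _.
  by rewrite mulrAC mulrA.
rewrite !sumv -!intrD ltr0z !c2 => pos.
have cji0 : c j i < 0.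
  have ji : j != i by rewrite eq_sym.
  by rewrite lt_neqAle cN // andbT; apply: contraTneq cij0 => /cz ->.
have := esym i j; have := e0 i; have := e0 j.
have [->|] := eqVneq (c i j) (-1); first by left.
have [->|] := eqVneq (c j i) (-1); first by right.
nia.
Qed.

Lemma even_pairE x k : even_pair x k =
  (2 * (d (ui x))%:Z %| k - ur x)%Z.
Proof. by rewrite /even_pair eqz_mod_dvd PoszM. Qed.

Lemma even_pairD x k l : even_pair x k ->
  even_pair x l = (2 * (d (ui x))%:Z %| l - k)%Z.
Proof.
rewrite !even_pairE => xk; rewrite -[l - ur x](subrKA k).
by rewrite rpredDr.
Qed.

Lemma ur_bounds x : 0 < ur x <= 2 * (d (ui x))%:Z.
Proof.
case: x => [[i a] xP]; rewrite /ur /ui /=.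
have /andP[/= a0 _] := xP; have := ltn_ord a; lia.
Qed.

Lemma uI_inj x y : ui x = ui y -> ur x = ur y -> x = y.
Proof.
case: x y => [[i a] xP] [[j b] yP]; rewrite /ui /ur /= => ij [ab].
by subst j; apply: val_inj => /=; congr existT; apply: val_inj.
Qed.

(** The values of [ur] over a given [i] lie in an interval containing each residue modulo [2 * d i]
    exactly once. *)
Lemma even_pair_eq x y k : ui x = ui y -> even_pair x k ->
  even_pair y k = (x == y).
Proof.
move=> xy xk; apply/idP/eqP => [yk|<- //]; apply: uI_inj => //.
move: xk yk (ur_bounds x) (ur_bounds y); rewrite !even_pairE -xy.
move=> /dvdzP[a aE] /dvdzP[b bE] ux uy.
have e : ur x - ur y = (b - a) * (2 * (d (ui x))%:Z) by rewrite mulrBl -aE -bE; ring.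
suff ab : b - a = 0 by rewrite ab in e; lia.
nia.
Qed.

Lemma cij_lt0C i j : (c i j < 0) = (c j i < 0).
Proof.
have := dsymP D i j; have := dsym_gt0 D i; have := dsym_gt0 D j.
by move=> di dj e; apply/idP/idP => h; nia.
Qed.

(** Adjacent vertices have opposite parities, so only one of the two orientations can occur; the
    right-hand side no longer mentions it. *)
Lemma uQarrowD x y : (uQarrow x y)%:Z + (uQarrow y x)%:Z =
  ((c (ui x) (ui y) < 0) && ((2 * gcdn (d (ui x)) (d (ui y)))%N%:Z
     %| ur x - ur y + bmat D (ui x) (ui y))%Z)%:Z :> int.
Proof.
rewrite /uQarrow /Qarrow -(cij_lt0C (ui x)).
have [cxy|//] := boolP (c (ui x) (ui y) < 0); rewrite !andTb.
have bC : bmat D (ui y) (ui x) = bmat D (ui x) (ui y) by rewrite /bmat dsymP.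
rewrite bC [gcdn (d (ui y)) _]gcdnC; set g := (2 * _)%N.
(* The two congruences agree because [2 b_ij] is divisible by [g]. *)
have -> : (g%:Z %| ur y - ur x + bmat D (ui x) (ui y))%Z
        = (g%:Z %| ur x - ur y + bmat D (ui x) (ui y))%Z.
  have gb : (g%:Z %| 2 * bmat D (ui x) (ui y))%Z.
    rewrite /g PoszM; apply: dvdz_mul => //.
    by apply: dvdz_mulr; exact: dvdn_gcdl.
  rewrite (_ : ur y - _ + _ = - (ur x - ur y + bmat D (ui x) (ui y))
                              + 2 * bmat D (ui x) (ui y)); last by ring.
  by rewrite rpredDr // rpredN.
have := parityP cxy; case: (parity D (ui x)); case: (parity D (ui y)) => //= _.
by rewrite addr0.
Qed.

Lemma coordsum_ax x y k : even_pair x k ->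
  coordsum [set k | even_pair y k] (ui y) (ax x k) = uC y x.
Proof.
move=> xk; have [c2 _ _] := cij_gcm D.
have xk' : even_pair x (k + 2 * (d (ui x))%:Z).
  by rewrite (even_pairD _ xk) addrC addKr.
have evE l : (l \in [set k | even_pair y k]) = even_pair y l.
  by apply/idP/idP; rewrite inE.
have nbr j : coordsum [set k | even_pair y k] (ui y)
    (\sum_(1 <= n < (absz (c (ui x) j)).+1)
      zvar j (k + bmat D (ui x) j + 2 * (d (ui x))%:Z * n%:Z)) =
    (j == ui y)%:Z * \sum_(1 <= n < (absz (c (ui x) j)).+1)
      (even_pair y (k + bmat D (ui x) j + 2 * (d (ui x))%:Z * n%:Z))%:Z.
  rewrite raddf_sum mulr_sumr; apply: eq_bigr => n _.
  by rewrite /= coordsumU evE; case: (j == ui y); rewrite ?mul1r ?mul0r.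
rewrite /ax /amono raddfB raddfD /= !coordsumU !evE (raddf_sum (coordsum _ _)) /=.
under eq_bigr do rewrite nbr.
rewrite /uC -[RHS]addrA -opprD [(uQarrow y x)%:Z + _]addrC uQarrowD.
congr (_ - _).
  have [xy|xy] := eqVneq (ui x) (ui y).
    by rewrite (even_pair_eq xy xk) (even_pair_eq xy xk') eq_sym; case: (_ == _).
  by rewrite (_ : (y == x) = false) //; apply: contra_neqF xy => /eqP ->.
have [cxy|cxy] := boolP (c (ui x) (ui y) < 0); last first.
  apply: big1 => j cj; case: eqP => [jy|_]; last by rewrite mul0r.
  by rewrite -jy cj in cxy.
rewrite (bigD1 (ui y)) //= eqxx mul1r [X in _ + X]big1 => [|j /andP[_ /negPf->]]; last first.
  by rewrite mul0r.
rewrite addr0.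
have e n : even_pair y (k + bmat D (ui x) (ui y) + 2 * (d (ui x))%:Z * n%:Z)
    = ((2 * d (ui y))%N%:Z %| (k + bmat D (ui x) (ui y) - ur y)
          + 2 * (d (ui x))%:Z * n%:Z)%Z.
  by rewrite even_pairE PoszM; congr (_ %| _)%Z; ring.
under eq_bigr do rewrite e.
have cyx : c (ui y) (ui x) < 0 by rewrite cij_lt0C.
rewrite (@gcd_dvd_count _ _ _ (absz (c (ui y) (ui x)))) ?dsym_gt0 //.
- congr (nat_of_bool _)%:Z.
  (* Since [k - ur x] is a multiple of [2 * d (ui x)], hence of twice the gcd, [k] may be replaced
     by [ur x]. *)
  rewrite (_ : k + _ - _ = ur x - ur y + bmat D (ui x) (ui y) + (k - ur x)).
    rewrite rpredDr //; apply: dvdz_trans (_ : 2 * (d (ui x))%:Z %| _)%Z.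
      by rewrite PoszM; apply: dvdz_mul => //; exact: dvdn_gcdl.
    by rewrite -even_pairE.
  by ring.
- have := dsymP D (ui x) (ui y); nia.
- by case: (cij_eqN1 cxy) => ->; [left|right].
Qed.

(** The neighbour factors drop out because [c i i = 2] is not negative; each of the two remaining
    factors counts once [l] reaches it. *)
Lemma coordsum_ax_le x k l : even_pair x k ->
  coordsum [set k | even_pair x k /\ k <= l] (ui x) (ax x k)
    = (k <= l)%R%:Z + (k + 2 * (d (ui x))%:Z <= l)%R%:Z.
Proof.
move=> xk; have [c2 _ _] := cij_gcm D.
have xk' : even_pair x (k + 2 * (d (ui x))%:Z).
  by rewrite (even_pairD _ xk) addrC addKr.
rewrite /ax /amono raddfB raddfD /= !coordsumU eqxx (raddf_sum (coordsum _ _)) big1 ?subr0 => [|j cj].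
  by congr (_ %:Z + _ %:Z); congr nat_of_bool; apply/idP/idP;
    rewrite inE /= ?xk ?xk' => // -[].
rewrite raddf_sum big1 // => n _; rewrite /= coordsumU.
by case: eqP cj => // ->; rewrite c2.
Qed.

(** * The functions [epsl] and [phil] and their extremal points *)

Lemma epslE x l u :
  epsl x l u = - coordsum [set k | even_pair x k /\ k <= l] (ui x) u.
Proof. by []. Qed.

Lemma epslD_ax x k l u : even_pair x k -> epsl x l (u + ax x k)
  = epsl x l u - (k <= l)%R%:Z - (k + 2 * (d (ui x))%:Z <= l)%R%:Z.
Proof. by move=> xk; rewrite !epslE raddfD /= coordsum_ax_le //; ring. Qed.

Lemma epslB_ax x k l u : even_pair x k -> epsl x l (u - ax x k)
  = epsl x l u + (k <= l)%R%:Z + (k + 2 * (d (ui x))%:Z <= l)%R%:Z.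
Proof. by move=> xk; rewrite !epslE raddfB /= coordsum_ax_le //; ring. Qed.

Lemma wtE x u : wt D u x = coordsum [set k | even_pair x k] (ui x) u.
Proof.
rewrite /wt.
have e y : \sum_(k \in [set k | even_pair y k]) fundw y *~ expo u (ui y) k
    = fundw y *~ coordsum [set k | even_pair y k] (ui y) u.
  rewrite (@fsumEr _ _ _ _ (coords u)); last first.
    by move=> k ku; rewrite /expo coords_out.
  by rewrite (@coordsumE _ (coords u)) // -mulrz_sumr.
under eq_bigr do rewrite e.
rewrite sum_ffunE (bigD1 x) //= big1 => [|y yx].
  by rewrite addr0 ffunMzE ffunE eqxx intz.
by rewrite ffunMzE ffunE (negPf yx) mul0rz.
Qed.

Lemma philE x l u : phil x l u = wt D u x + epsl x l u.
Proof.
rewrite wtE (coordsumID _ [set k | k <= l]) epslE addrAC.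
rewrite -[LHS]add0r; congr (_ + _); first by apply/esym/subrr.
apply: eq_fsbigl; apply/seteqP; split=> k /= [xk]; first by move/lt_geF->.
by move/negP; rewrite -ltNge.
Qed.

(** Such a zero value forces [eps] to be nonnegative, and keeps the points where a nonzero maximum
    is attained away from minus infinity. *)
Lemma epsl_eq0 x u : exists N : int, forall l, l < N -> epsl x l u = 0.
Proof.
have [N uN] := coords_bounded u; exists (- N%:Z) => l lN.
by rewrite epslE coordsum0 ?oppr0 // => k [_ kl]; apply: uN; lia.
Qed.

Lemma phil_eq0 x u : exists N : int, forall l, N < l -> phil x l u = 0.
Proof.
have [N uN] := coords_bounded u; exists N%:Z => l lN.
by apply: coordsum0 => k [_ kl]; apply: uN; lia.
Qed.

Lemma even_pair_lt x (N : int) : exists2 l, even_pair x l & l < N.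
Proof.
have d0 := dsym_gt0 D (ui x); have /andP[ur0 _] := ur_bounds x.
exists (ur x - 2 * (d (ui x))%:Z * (`|ur x|%N%:Z + `|N|%N%:Z + 1)); last by nia.
by rewrite even_pairE addrC addKr rpredN dvdz_mulr.
Qed.

Lemma even_pair_gt x (N : int) : exists2 l, even_pair x l & N < l.
Proof.
have d0 := dsym_gt0 D (ui x); have /andP[ur0 _] := ur_bounds x.
exists (ur x + 2 * (d (ui x))%:Z * (`|ur x|%N%:Z + `|N|%N%:Z + 1)); last by nia.
by rewrite even_pairE addrC addKr dvdz_mulr.
Qed.

Lemma eps_spec x u : (exists2 l, even_pair x l & epsl x l u = eps x u) /\
  (forall l, even_pair x l -> epsl x l u <= eps x u).
Proof.
have [||[l xl e] ub] := @maxZP 0 [set epsl x l u | l in [set l | even_pair x l]].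
- by exists (epsl x (ur x) u), (ur x) => //=; rewrite /even_pair.
- have [M uM] := coordsum_bounded (ui x) u.
  exists M => _ [l _ <-]; apply: le_trans (ler_norm _) _.
  by rewrite epslE normrN.
by split=> [|m xm]; [exists l|apply: ub; exists m].
Qed.

Lemma eps_eq x u l : even_pair x l ->
  (forall m, even_pair x m -> epsl x m u <= epsl x l u) -> eps x u = epsl x l u.
Proof.
move=> xl le_l; apply/eqP; rewrite eq_le.
by have [[m xm <-] ->] := eps_spec x u; rewrite ?le_l.
Qed.

Lemma phi_eps x u : phi x u = wt D u x + eps x u.
Proof.
have [[l xl e] ub] := eps_spec x u.
apply: maxZ_eq; first by exists l; rewrite // philE e.
by move=> _ [m xm <-]; rewrite philE lerD2l ub.
Qed.

Lemma eps_ge0 x u : 0 <= eps x u.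
Proof.
have [N eN] := epsl_eq0 x u; have [l xl /eN <-] := even_pair_lt x N.
by have [_] := eps_spec x u; apply.
Qed.

Lemma phi_ge0 x u : 0 <= phi x u.
Proof.
have [N pN] := phil_eq0 x u; have [l xl /pN <-] := even_pair_gt x N.
by rewrite philE phi_eps lerD2l; have [_] := eps_spec x u; apply.
Qed.

Lemma mx_spec x u : eps x u != 0 -> epsl x (mx x u) u = eps x u /\
  (forall l, even_pair x l -> l < mx x u -> epsl x l u < eps x u).
Proof.
move=> e0; have [[l xl le] ub] := eps_spec x u.
have [||[_ me] lb] :=
    @minZP (ur x) [set l | even_pair x l /\ epsl x l u = eps x u].
- by exists l.
- have [N eN] := epsl_eq0 x u; exists N => m [_ me].
  by rewrite leNgt; apply: contra_neqN e0 => /eN <-.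
split=> // k xk; rewrite ltNge lt_neqAle ub // andbT.
by apply: contra => /eqP ke; apply: lb.
Qed.

(** As [phil] and [epsl] differ by a constant in [l], both attain their maxima at the same points;
    this puts [nx] and [mx] on the same footing. *)
Lemma nx_spec x u : phi x u != 0 -> epsl x (nx x u) u = eps x u /\
  (forall l, even_pair x l -> nx x u < l -> epsl x l u < eps x u).
Proof.
move=> p0; have [[l xl le] ub] := eps_spec x u.
have [||[_ me] lb] :=
    @maxZP (ur x) [set l | even_pair x l /\ phil x l u = phi x u].
- by exists l; rewrite /= philE phi_eps le.
- have [N pN] := phil_eq0 x u; exists N => m [_ me].
  by rewrite leNgt; apply: contra_neqN p0 => /pN <-.
split=> [|k xk].
  by apply: (@addrI _ (wt D u x)); rewrite -philE -phi_eps.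
rewrite ltNge lt_neqAle ub // andbT.
by apply: contra => /eqP ke; apply: lb; rewrite /= philE phi_eps ke.
Qed.

(** Hence an even position strictly after [k] sees both jumps caused by [ax x k], never just one. *)
Lemma even_pair_step x k l : even_pair x k -> even_pair x l -> k < l ->
  k + 2 * (d (ui x))%:Z <= l.
Proof.
move=> xk; rewrite (even_pairD _ xk) => /dvdzP[q qE] kl.
have d0 := dsym_gt0 D (ui x).
have q0 : 0 < q by nia.
nia.
Qed.

Lemma mx_eq x u l : even_pair x l -> epsl x l u = eps x u ->
  (forall m, even_pair x m -> m < l -> epsl x m u != eps x u) -> mx x u = l.
Proof.
move=> xl le lt_l; apply: minZ_eq => // m [xm me]; rewrite leNgt; apply/negP.
by move/(lt_l _ xm); rewrite me eqxx.
Qed.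

Lemma nx_eq x u l : even_pair x l -> epsl x l u = eps x u ->
  (forall m, even_pair x m -> l < m -> epsl x m u != eps x u) -> nx x u = l.
Proof.
move=> xl le gt_l; apply: maxZ_eq; first by rewrite /= philE phi_eps le.
move=> m [xm]; rewrite philE phi_eps => /addrI me; rewrite leNgt; apply/negP.
by move/(gt_l _ xm); rewrite me eqxx.
Qed.

(** * Effect of the crystal operators *)

Lemma wt_ax x k : even_pair x k -> wt D (ax x k) = simple_root (@uC I D) x.
Proof. by move=> xk; apply/ffunP => y; rewrite wtE coordsum_ax // ffunE. Qed.

Lemma wtD u v : wt D (u + v) = wt D u + wt D v.
Proof. by apply/ffunP => x; rewrite [RHS]ffunE !wtE raddfD. Qed.

Lemma wtN u : wt D (- u) = - wt D u.
Proof. by apply/ffunP => x; rewrite [RHS]ffunE !wtE raddfN. Qed.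

Lemma uCxx x : uC x x = 2.
Proof.
rewrite /uC eqxx /uQarrow /Qarrow; have [c2 _ _] := cij_gcm D.
by rewrite c2.
Qed.

Lemma e_spec x u (u' := u + ax x (mx x u)) : eps x u != 0 ->
  [/\ wt D u' = wt D u + simple_root (@uC I D) x, eps x u' = eps x u - 1,
      phi x u' = phi x u + 1 & nx x u' = mx x u].
Proof.
move=> e0; have xm := even_pair_mx x u; set m := mx x u in u' xm *.
have [me lt_m] := mx_spec e0; have [_ ub] := eps_spec x u.
have d0 := dsym_gt0 D (ui x).
have epsm : epsl x m u' = eps x u - 1.
  by rewrite epslD_ax // me; lia.
have eps' : eps x u' = eps x u - 1.
  rewrite -epsm; apply: eps_eq => // l xl; rewrite epsm epslD_ax //.
  (* Before [m] the old value is at most [eps - 1] by integrality; after [m] it drops by 2. *)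
  have := ub _ xl; have := lt_m _ xl; have := even_pair_step xm xl; lia.
have wt' : wt D u' = wt D u + simple_root (@uC I D) x by rewrite wtD wt_ax.
split=> //; first by rewrite !phi_eps wt' eps' !ffunE uCxx; ring.
apply: nx_eq => //; first by rewrite epsm.
move=> l xl ml; rewrite eps' epslD_ax //.
have := ub _ xl; have := even_pair_step xm xl; lia.
Qed.

Lemma f_spec x u (u' := u - ax x (nx x u)) : phi x u != 0 ->
  [/\ wt D u' = wt D u - simple_root (@uC I D) x, eps x u' = eps x u + 1,
      phi x u' = phi x u - 1 & mx x u' = nx x u].
Proof.
move=> p0; have xn := even_pair_nx x u; set n := nx x u in u' xn *.
have [ne lt_n] := nx_spec p0; have [_ ub] := eps_spec x u.
have d0 := dsym_gt0 D (ui x).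
have epsn : epsl x n u' = eps x u + 1.
  by rewrite epslB_ax // ne; lia.
have eps' : eps x u' = eps x u + 1.
  rewrite -epsn; apply: eps_eq => // l xl; rewrite epsn epslB_ax //.
  (* Past [n] the old value is at most [eps - 1], so the jump of 2 lifts it to at most [eps + 1];
     before [n] nothing changes. *)
  have := ub _ xl; have := lt_n _ xl; have := even_pair_step xn xl; lia.
have wt' : wt D u' = wt D u - simple_root (@uC I D) x.
  by rewrite wtD wtN wt_ax.
split=> //; first by rewrite !phi_eps wt' eps' !ffunE uCxx; ring.
apply: mx_eq => //; first by rewrite epsn.
move=> l xl ln; rewrite eps' epslB_ax //.
have := ub _ xl; have := even_pair_step xl xn; lia.
Qed.

End Crystal.

Theorem proposition4p4p6 (I : finType) (D : cartan_datum I) :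
  is_crystal (@uC I D) (fun u : evenM D => wt D u)
    (fun x (u : evenM D) => eps x u) (fun x (u : evenM D) => phi x u)
    (@etilde I D) (@ftilde I D).
Proof.
split=> [x u|x u u'|x u u'|x u u'].
- by rewrite phi_eps addrK.
- by rewrite /etilde; case: eqP => // /eqP /e_spec[? ? ? _] [<-].
- by rewrite /ftilde; case: eqP => // /eqP /f_spec[? ? ? _] [<-].
rewrite /etilde /ftilde; split; case: eqP => // /eqP nz [<-] /=.
(* As [eps] is nonnegative, [eps + 1] is nonzero and [etilde] is defined here; the first maximum of
   the new monomial is the old [nx x u], so the same factor is restored. *)
- have [_ e1 _ m1] := f_spec nz; rewrite e1 ifF; last first.
    by have := eps_ge0 x u; lia.
  by congr Some; apply: val_inj; rewrite /= m1 subrK.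
have [_ _ p1 n1] := e_spec nz; rewrite p1 ifF; last first.
  by have := phi_ge0 x u'; lia.
by congr Some; apply: val_inj; rewrite /= n1 addrK.
Qed.
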